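(* Let $1<p\le 2$ and let $\|\cdot\|_p$ be the $\ell_p$-norm on $\mathbb{R}^n$. Let $C\subset\mathbb{R}^n$ be a nonempty convex set. Then the norm function $f(x)=\|x\|_p$ is $\sigma$-strongly quasiconvex on $C$ for some $\sigma>0$ if and only if $C$ is bounded.
   Context: Let $C\subset\mathbb{R}^n$ be a nonempty convex set and $\sigma>0$. A function $f\colon C\to[-\infty,\infty]$ is $\sigma$-strongly quasiconvex on $C$ if $$f(\lambda x+(1-\lambda)y)\le\max\{f(x),f(y)\}-\frac{\sigma}{2}\lambda(1-\lambda)\|x-y\|_2^2$$ for all $x,y\in C$ and all $\lambda\in(0,1)$. Here $\|\cdot\|_2$ is the Euclidean norm, which is always the norm used in the last term, regardless of $p$. *)

(* Defs.v *)
From HB Require Import structures.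
From mathcomp Require Import all_boot all_order all_algebra.
From mathcomp Require Import all_classical all_reals all_analysis.

Set Implicit Arguments.
Unset Strict Implicit.
Unset Printing Implicit Defensive.
Import Order.TTheory GRing.Theory Num.Theory.
Import numFieldNormedType.Exports.

Local Open Scope classical_set_scope.
Local Open Scope ring_scope.

(* [`|x|] on ['rV[R]_n] is the library's sup norm, hence the separate
   definition of the l_p-norm. *)
Definition lp_norm (R : realType) (n : nat) (p : R) (x : 'rV[R]_n) : R :=
  (\sum_(i < n) `|x 0 i| `^ p) `^ p^-1.

(* [f] is total on the ambient space, but only its values on [C] are
   constrained. *)
Definition strongly_quasiconvex (R : realType) (n : nat) (sigma : R)
    (C : set 'rV[R]_n) (f : 'rV[R]_n -> \bar R) : Prop :=
  forall x y : 'rV[R]_n, C x -> C y -> forall lambda : R, 0 < lambda < 1 ->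
    (f (lambda *: x + (1 - lambda) *: y)%R <=
     maxe (f x) (f y)
     - (sigma / 2 * lambda * (1 - lambda) * lp_norm 2 (x - y) ^+ 2)%:E)%E.

(* Main.v *)
Require Import Defs.
From mathcomp Require Import all_boot all_order all_algebra.
From mathcomp Require Import all_classical all_reals all_analysis.
From mathcomp Require Import lra ring.
Import Order.TTheory GRing.Theory Num.Theory.
Import numFieldNormedType.Exports.
Local Open Scope classical_set_scope.
Local Open Scope ring_scope.

Set Implicit Arguments.
Unset Strict Implicit.

(** On [[0, r]] the second derivative of [v^p - c v^2] is nonnegative for
    [c = (p - 1) / 2 r^(p - 2)], so [v^p - c v^2] is convex there, and it is
    nondecreasing; hence [|v|^p - c v^2] is convex on [[-r, r]], and summing
    over the coordinates, the p-th power of the l_p-norm is strongly convex for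
    the Euclidean norm on any sup-norm ball.  Strong quasiconvexity of the norm
    follows by taking p-th roots, using
    [M^p - u^p <= 2 M^(p - 1) (M - u)].  Conversely, the midpoint inequality
    against a fixed [y] in [C] bounds [|x - y|^2] by a function of [x] of linear
    growth. *)

(** * Scalar inequalities for the p-th power *)

Lemma ler_powR_npos (R : realType) (s u v : R) :
  s <= 0 -> 0 < u -> u <= v -> v `^ s <= u `^ s.
Proof.
move=> s0 u0 uv; rewrite -(opprK s) !(powRN _ (- s)).
rewrite lef_pV2 ?posrE ?powR_gt0//; last by apply: lt_le_trans uv.
by apply: ge0_ler_powR; rewrite ?nnegrE; lra.
Qed.

Lemma powR_sub_sqr_convex (R : realType) (p c r a b t : R) :
  1 < p -> p <= 2 -> c <= (p - 1) / 2 * r `^ (p - 2) ->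
  0 <= a -> a <= b -> b <= r -> 0 <= t <= 1 ->
  (t * a + (1 - t) * b) `^ p - c * (t * a + (1 - t) * b) ^+ 2
  <= t * (a `^ p - c * a ^+ 2) + (1 - t) * (b `^ p - c * b ^+ 2).
Proof.
move=> p1 p2 cr a0 ab br t01.
pose h (v : R) : R := v `^ p - c * v ^+ 2.
pose dh (v : R) : R := p * v `^ (p - 1) - c * (2 * v).
pose ddh (v : R) : R := p * ((p - 1) * v `^ (p - 2)) - c * 2.
have dP (v : R) : 0 < v -> is_derive v 1 h (dh v).
  move=> v0; rewrite /h /dh.
  have ? := is_derive1_powR p v0.
  apply: is_derive_eq.
  by rewrite /= /GRing.scale /=; ring.
have ddP (v : R) : 0 < v -> is_derive v 1 dh (ddh v).
  move=> v0; rewrite /dh /ddh.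
  have -> : p - 2 = p - 1 - 1 by lra.
  have ? := is_derive1_powR (p - 1) v0.
  apply: is_derive_eq.
  by rewrite /= /GRing.scale /=; ring.
have nearE (v : R) : 0 < v -> \forall u \near v, dh u = 'D_1 h u.
  move=> v0; near=> u.
  have u0 : 0 < u by near: u; exact: lt_nbhsr.
  by have [_ ->] := dP u u0.
have D2 (v : R) : 0 < v -> is_derive v 1 ('D_1 h) (ddh v).
  by move=> v0; exact: near_eq_is_derive (nearE v v0) (ddP v v0).
have ch (v : R) : 0 < v -> h x @[x --> v] --> h v.
  move=> v0; apply: differentiable_continuous.
  by apply/derivable1_diffP; have [] := dP v v0.
move: (ab); rewrite le_eqVlt => /predU1P[<-|ltab].
  by rewrite -!mulrDl subrKC !mul1r.
have b0 : 0 < b by apply: le_lt_trans ltab.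
have vpos (v : R) : v \in `]a, b[ -> 0 < v.
  by rewrite in_itv/= => /andP[av _]; apply: le_lt_trans av.
have /andP[t0 t1] := t01.
apply: (@second_derivative_convex R h a b _ _ _ _ _ (Itv01 t0 t1)) => //.
- move=> x /andP[ax xb]; have x0 : 0 < x by apply: le_lt_trans ax.
  have [_ ->] := D2 x x0.
  (* Here [2 c <= (p - 1) r^(p - 2) <= (p - 1) x^(p - 2)], and the extra factor [p >= 1] only
     enlarges the right side. *)
  rewrite /ddh.
  have : r `^ (p - 2) <= x `^ (p - 2).
    by apply: ler_powR_npos; lra.
  have := powR_ge0 r (p - 2).
  move: (r `^ _) (x `^ _) cr => A B cA A0 AB.
  have BA : (p - 1) * A <= (p - 1) * B by rewrite ler_wpM2l//; lra.
  have : (p - 1) * B <= p * ((p - 1) * B).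
    by rewrite ler_peMl ?mulr_ge0//; lra.
  lra.
- exact/cvg_at_left_filter/ch.
- move: a0; rewrite le_eqVlt => /predU1P[<-|a0]; last first.
    exact/cvg_at_right_filter/ch.
  rewrite /h powR0; last by rewrite gt_eqF//; lra.
  apply: cvgB; first by apply: powR_cvg0; lra.
  apply: cvg_at_right_filter.
  by apply: cvgMl_tmp; exact: exprn_continuous.
- by move=> x /vpos/dP[].
- by move=> x /vpos/D2[].
Unshelve. all: by end_near. Qed.

Lemma powR_split_sqr (R : realType) (p v : R) :
  0 < v -> v `^ p = v `^ (p - 2) * v ^+ 2.
Proof.
move=> v0; rewrite -powR_mulrn ?ltW// -powRD ?subrK//.
by apply/implyP => _; rewrite gt_eqF.
Qed.

(** Since [u^p <= u v^(p - 1)], the right side minus the left is at least [(v - u) v (v^(p - 2) - 2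
    c) + c (v - u)^2], and [2 c <= v^(p - 2)]. *)
Lemma powR_sub_sqr_homo (R : realType) (p c r u v : R) :
  1 < p -> p <= 2 -> 0 <= c -> c <= (p - 1) / 2 * r `^ (p - 2) ->
  0 <= u -> u <= v -> v <= r ->
  u `^ p - c * u ^+ 2 <= v `^ p - c * v ^+ 2.
Proof.
move=> p1 p2 c0 cr u0 uv vr.
have [v0|v0] := eqVneq v 0.
  by have -> : u = v by apply/le_anti; rewrite uv v0 u0.
have v_gt0 : 0 < v by rewrite lt0r v0 (le_trans u0).
have cv : 2 * c <= v `^ (p - 2).
  have : r `^ (p - 2) <= v `^ (p - 2) by apply: ler_powR_npos => //; lra.
  have := powR_ge0 r (p - 2).
  move: (r `^ _) (v `^ _) cr => A B cA A0 AB.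
  by have : (p - 1) * A <= A by [rewrite ler_piMl//; lra]; lra.
have vE : v `^ (p - 1) = v * v `^ (p - 2).
  by rewrite -mulr_powRB1 ?ltW// ; [congr (_ * _ `^ _); ring | lra].
have uB : u `^ p <= u * v `^ (p - 1).
  rewrite -mulr_powRB1//; last lra.
  by rewrite ler_wpM2l//; apply: ge0_ler_powR; rewrite ?nnegrE//; lra.
have : 0 <= (v - u) * v * (v `^ (p - 2) - 2 * c).
  by rewrite !mulr_ge0// ?subr_ge0// ltW.
have : 0 <= c * (v - u) ^+ 2 by rewrite mulr_ge0// sqr_ge0.
rewrite (powR_split_sqr p v_gt0); move: uB; rewrite vE.
move: (v `^ _) (u `^ _) => B A; nra.
Qed.

(** Monotonicity of [v^p - c v^2] replaces [|m|] by [M], and convexity applies between [|x|] and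
    [|y|]. The quadratic terms combine through [t x^2 + (1 - t) y^2 - m^2 = t (1 - t) (x - y)^2]. *)
Lemma powR_norm_strongly_convex (R : realType) (p c r x y t : R) :
  1 < p -> p <= 2 -> 0 <= c -> c <= (p - 1) / 2 * r `^ (p - 2) ->
  `|x| <= r -> `|y| <= r -> 0 <= t <= 1 ->
  `|t * x + (1 - t) * y| `^ p <=
  t * `|x| `^ p + (1 - t) * `|y| `^ p - c * (t * (1 - t) * (x - y) ^+ 2).
Proof.
move=> p1 p2 c0 cr xr yr; wlog xy : x y t xr yr / `|x| <= `|y|.
  move=> wl t01; have [xy|/ltW yx] := leP `|x| `|y|; first exact: wl.
  have := wl y x (1 - t) yr xr yx.
  have -> : 1 - (1 - t) = t by ring.
  rewrite [_ * y + _]addrC [_ * _ `^ p + _]addrC (mulrC (1 - t) t).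
  rewrite -(sqrrN (y - x)) opprB.
  by apply; lra.
move=> /andP[t0 t1].
have t1' : 0 <= 1 - t by rewrite subr_ge0.
set m := t * x + _; set M := t * `|x| + (1 - t) * `|y|.
have mM : `|m| <= M.
  rewrite (le_trans (ler_normD _ _))// !normrM.
  by rewrite (ger0_norm t0) (ger0_norm t1').
have Mr : M <= r.
  have -> : r = t * r + (1 - t) * r by ring.
  by rewrite lerD// ler_wpM2l.
have := powR_sub_sqr_homo p1 p2 c0 cr (normr_ge0 m) mM Mr.
move=> /le_trans /(_ (powR_sub_sqr_convex p1 p2 cr (normr_ge0 x) xy yr _)).
rewrite t0 t1 => /(_ isT); rewrite !real_normK ?num_real// /m.
move: (`|_| `^ p) (`|_| `^ p) (`|_| `^ p) => A B D.
lra.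
Qed.

(** For [u > 0], [v^(p - 2) <= u^(p - 2)] gives [v^p - u^p <= v^(p - 2) (v^2 - u^2)], and
    [v + u <= 2 v] yields the constant 2. *)
Lemma powR_sub_le (R : realType) (p u v : R) :
  1 < p -> p <= 2 -> 0 <= u -> u <= v ->
  v `^ p - u `^ p <= 2 * v `^ (p - 1) * (v - u).
Proof.
move=> p1 p2; rewrite le_eqVlt => /predU1P[<- v0|u0 uv].
  rewrite powR0 ?gt_eqF ?subr0//; last lra.
  have := powR_ge0 v p; rewrite -mulrA (mulrC _ v) mulr_powRB1//; lra.
have v0 : 0 < v by apply: lt_le_trans uv.
have vE : v `^ (p - 1) = v * v `^ (p - 2).
  by rewrite -mulr_powRB1 ?ltW// ; [congr (_ * _ `^ _); ring | lra].
rewrite vE (powR_split_sqr p v0) (powR_split_sqr p u0).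
have uv2 : 0 <= u ^+ 2 * (u `^ (p - 2) - v `^ (p - 2)).
  by rewrite mulr_ge0 ?sqr_ge0// subr_ge0 ler_powR_npos//; lra.
have : 0 <= v `^ (p - 2) * (v - u) ^+ 2 by rewrite mulr_ge0 ?sqr_ge0 ?powR_ge0.
lra.
Qed.

(** * Comparison of l_p and Euclidean norms with the sup norm *)

Section lp_norm.
Variables (R : realType) (n : nat).
Implicit Types (p : R) (x : 'rV[R]_n).

Lemma lp_norm_ge0 p x : 0 <= lp_norm p x.
Proof. exact: powR_ge0. Qed.

Lemma lp_norm_powR p x : 0 < p -> lp_norm p x `^ p = \sum_(i < n) `|x 0 i| `^ p.
Proof.
move=> p0; rewrite -powRrM mulVf ?gt_eqF// powRr1//.
by apply: sumr_ge0 => i _; exact: powR_ge0.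
Qed.

Lemma lp_norm2_sqr x : lp_norm 2 x ^+ 2 = \sum_(i < n) x 0 i ^+ 2.
Proof.
rewrite -powR_mulrn ?lp_norm_ge0// lp_norm_powR//.
by apply: eq_bigr => i _; rewrite powR_mulrn// real_normK ?num_real.
Qed.

Lemma normr_coord_le x i : `|x 0 i| <= `|x|.
Proof.
rewrite /Num.norm /= mx_normrE.
exact: (le_bigmax _ (fun ij : 'I_1 * 'I_n => `|x ij.1 ij.2|) (ord0, i)).
Qed.

Lemma lp_norm_le p x : 0 < p -> lp_norm p x <= n%:R `^ p^-1 * `|x|.
Proof.
move=> p0; have -> : `|x| = (`|x| `^ p) `^ p^-1.
  by rewrite -powRrM mulfV ?gt_eqF// powRr1.
rewrite -powRM ?powR_ge0//; apply: ge0_ler_powR.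
- by rewrite invr_ge0 ltW.
- by rewrite nnegrE; apply: sumr_ge0 => i _; exact: powR_ge0.
- by rewrite nnegrE mulr_ge0 ?powR_ge0.
- rewrite mulr_natl (_ : _ *+ n = \sum_(i < n) `|x| `^ p); last first.
    by rewrite sumr_const card_ord.
  apply: ler_sum => i _.
  by apply: ge0_ler_powR; rewrite ?nnegrE ?normr_coord_le ?(ltW p0).
Qed.

Lemma norm_le_lp_norm2 x : `|x| ^+ 2 <= lp_norm 2 x ^+ 2.
Proof.
rewrite lp_norm2_sqr; have [->|x0] := eqVneq `|x| 0.
  by rewrite expr0n/= sumr_ge0// => i _; exact: sqr_ge0.
have [[i j] /= xE] := mx_norm_neq0 x0.
have -> : `|x| = `|x i j| := xE.
rewrite ord1 real_normK ?num_real// (bigD1 j)//= lerDl.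
by apply: sumr_ge0 => k _; exact: sqr_ge0.
Qed.

End lp_norm.

(** * Strong quasiconvexity on bounded sets *)

Lemma strongly_quasiconvex_EFin (R : realType) (n : nat) (sigma : R)
    (C : set 'rV[R]_n) (f : 'rV[R]_n -> R) :
  strongly_quasiconvex sigma C (fun x => (f x)%:E) <->
  forall x y, C x -> C y -> forall t, 0 < t < 1 ->
    f (t *: x + (1 - t) *: y) <=
    Num.max (f x) (f y) - sigma / 2 * t * (1 - t) * lp_norm 2 (x - y) ^+ 2.
Proof.
by split=> H x y Cx Cy t t01; have := H x y Cx Cy t t01;
  rewrite -EFin_max -EFinB lee_fin.
Qed.

(** The sup-norm bound [r] controls every coordinate, so one [c] serves them all and the scalar
    inequalities add up. *)
Lemma lp_norm_powR_strongly_convex (R : realType) (n : nat) (p c r t : R)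
    (x y : 'rV[R]_n) :
  1 < p -> p <= 2 -> 0 <= c -> c <= (p - 1) / 2 * r `^ (p - 2) ->
  `|x| <= r -> `|y| <= r -> 0 <= t <= 1 ->
  lp_norm p (t *: x + (1 - t) *: y) `^ p <=
  t * lp_norm p x `^ p + (1 - t) * lp_norm p y `^ p -
  c * (t * (1 - t) * lp_norm 2 (x - y) ^+ 2).
Proof.
move=> p1 p2 c0 cr xr yr t01; have p0 : 0 < p := lt_trans ltr01 p1.
have := (lp_norm_powR (t *: x + (1 - t) *: y) p0, lp_norm_powR x p0,
         lp_norm_powR y p0).
(* Rewriting before this generalization would compare the norms of distinct
   vectors by unfolding [powR] (minutes). *)
move: (lp_norm p (_ + _)) (lp_norm p x) (lp_norm p y) => fz fx fy [[-> ->] ->].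
rewrite lp_norm2_sqr !mulr_sumr -big_split -sumrB/=.
apply: ler_sum => i _; rewrite !mxE.
apply: (@powR_norm_strongly_convex _ _ _ r) => //.
- by rewrite (le_trans (normr_coord_le _ _)).
- by rewrite (le_trans (normr_coord_le _ _)).
Qed.

(** Extraction of p-th roots: a gap [d] between p-th powers becomes a gap between the bases. The
    product form, without division, allows [M = 0]. *)
Lemma le_sub_of_powR (R : realType) (p M u d : R) :
  1 < p -> p <= 2 -> 0 <= M -> 0 <= u -> 0 <= d ->
  u `^ p <= M `^ p - d -> u <= M /\ d <= 2 * M `^ (p - 1) * (M - u).
Proof.
move=> p1 p2 M0 u0 d0 ud.
have uM : u <= M.
  rewrite leNgt; apply/negP => Mu.
  have : M `^ p < u `^ p by apply: gt0_ltr_powR; rewrite ?nnegrE//; lra.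
  lra.
by split=> //; have := powR_sub_le p1 p2 u0 uM; lra.
Qed.

(** The factor [M^(p - 1)] from the root extraction varies with [x] and [y]; bounding it by
    [K^(p - 1)] makes a uniform [sigma] possible. *)
Lemma lp_norm_conv_le (R : realType) (n : nat) (p c r K t : R)
    (x y : 'rV[R]_n) :
  1 < p -> p <= 2 -> 0 <= c -> c <= (p - 1) / 2 * r `^ (p - 2) ->
  `|x| <= r -> `|y| <= r -> lp_norm p x <= K -> lp_norm p y <= K ->
  0 <= t <= 1 ->
  c * (t * (1 - t) * lp_norm 2 (x - y) ^+ 2) <=
  2 * K `^ (p - 1) *
  (Num.max (lp_norm p x) (lp_norm p y) - lp_norm p (t *: x + (1 - t) *: y)).
Proof.
move=> p1 p2 c0 cr xr yr xK yK t01; have /andP[t0 t1] := t01.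
have p0 : 0 < p := lt_trans ltr01 p1.
have := lp_norm_powR_strongly_convex p1 p2 c0 cr xr yr t01.
have := lp_norm_ge0 p (t *: x + (1 - t) *: y).
move: (lp_norm p (_ + _)) => fz.
have D0 : 0 <= lp_norm 2 (x - y) ^+ 2 by exact: sqr_ge0.
move: (lp_norm 2 _ ^+ 2) D0 => D D0.
move: (lp_norm p x) (lp_norm p y) (lp_norm_ge0 p x) (lp_norm_ge0 p y) xK yK.
move=> fx fy fx0 fy0 xK yK fz0 H.
set M := Num.max fx fy.
have M0 : 0 <= M by rewrite le_max fx0.
have xM : fx <= M by rewrite le_max lexx.
have yM : fy <= M by rewrite le_max lexx orbT.
have MK : M <= K by rewrite ge_max xK.
have d0 : 0 <= c * (t * (1 - t) * D) by rewrite !mulr_ge0// subr_ge0.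
have [zM] : fz <= M /\ c * (t * (1 - t) * D) <= 2 * M `^ (p - 1) * (M - fz).
  apply: le_sub_of_powR => //; apply: (le_trans H).
  rewrite lerD2r (_ : M `^ p = t * M `^ p + (1 - t) * M `^ p); last by ring.
  have powM f : 0 <= f -> f <= M -> f `^ p <= M `^ p.
    by move=> f0 fM; apply: ge0_ler_powR; rewrite ?nnegrE// ltW.
  by rewrite lerD// ler_wpM2l ?subr_ge0// powM.
move=> /le_trans; apply; rewrite ler_wpM2r ?subr_ge0// ler_wpM2l//.
by apply: ge0_ler_powR; rewrite ?nnegrE ?subr_ge0 ?(ltW p1)// (le_trans M0).
Qed.

Lemma lp_norm_strongly_quasiconvex (R : realType) (n : nat) (p r : R)
    (C : set 'rV[R]_n) :
  1 < p -> p <= 2 -> 0 < r -> (forall x, C x -> `|x| <= r) ->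
  exists2 sigma, 0 < sigma &
    strongly_quasiconvex sigma C (fun x => (lp_norm p x)%:E).
Proof.
move=> p1 p2 r0 Cr; have p0 : 0 < p := lt_trans ltr01 p1.
pose c := (p - 1) / 2 * r `^ (p - 2).
have c0 : 0 < c by rewrite mulr_gt0 ?powR_gt0//; lra.
(* The summand 1 keeps [K] positive even for [n = 0], so that [K^(p - 1)] can be divided by. *)
pose K := n%:R `^ p^-1 * r + 1.
have K0 : 0 < K by rewrite ltr_wpDl// mulr_ge0 ?powR_ge0 ?ltW.
have CK x : C x -> lp_norm p x <= K.
  move=> /Cr xr; rewrite (le_trans (lp_norm_le _ p0))// /K.
  by rewrite (@le_trans _ _ (n%:R `^ p^-1 * r)) ?lerDl// ler_wpM2l ?powR_ge0.
have Kp0 : 0 < K `^ (p - 1) by exact: powR_gt0.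
(* The 2 in [2 * K^(p - 1)] cancels against the [sigma / 2] of the definition. *)
exists (c / K `^ (p - 1)); first exact: divr_gt0.
apply/strongly_quasiconvex_EFin => x y Cx Cy t /andP[t0 t1].
have t01 : 0 <= t <= 1 by rewrite !ltW.
have := lp_norm_conv_le p1 p2 (ltW c0) (lexx _) (Cr x Cx) (Cr y Cy)
  (CK x Cx) (CK y Cy) t01.
move: (lp_norm p (_ + _)) (Num.max _ _) (lp_norm 2 _ ^+ 2) => fz M D H.
rewrite lerBrDr -lerBrDl.
rewrite (_ : _ * D = c * (t * (1 - t) * D) / (2 * K `^ (p - 1))); last first.
  by field; rewrite gt_eqF.
by rewrite ler_pdivrMr ?mulr_gt0// [leRHS]mulrC.
Qed.

(** * Boundedness from strong quasiconvexity *)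

Lemma strongly_quasiconvex_lp_norm_bounded (R : realType) (n : nat)
    (p sigma : R) (C : set 'rV[R]_n) (x y : 'rV[R]_n) :
  0 < p -> 0 < sigma ->
  strongly_quasiconvex sigma C (fun x => (lp_norm p x)%:E) -> C x -> C y ->
  `|x| <= 1 + 8 / sigma * (n%:R `^ p^-1 * (1 + 2 * `|y|)) + `|y|.
Proof.
move=> p0 s0 /strongly_quasiconvex_EFin qc Cx Cy.
set N := n%:R `^ p^-1; have N0 : 0 <= N := powR_ge0 _ _.
set d := `|x - y|; have d0 : 0 <= d := normr_ge0 _.
have xd : `|x| <= d + `|y| by rewrite -{1}(subrK y x) ler_normD.
have y0 := normr_ge0 y.
(* At [t = 1/2] the modulus [sigma / 2 * t * (1 - t)] is [sigma / 8]; the norm at the midpoint is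
   bounded below by 0, and the Euclidean norm of [x - y] by [d]. *)
have main : sigma / 8 * d ^+ 2 <= N * (d + 2 * `|y|).
  have h : 0 < (2^-1 : R) < 1 by apply/andP; split; lra.
  have := le_trans (lp_norm_ge0 _ _) (qc _ _ Cx Cy _ h).
  have := norm_le_lp_norm2 (x - y); rewrite -/d.
  have : Num.max (lp_norm p x) (lp_norm p y) <= N * (d + 2 * `|y|).
    have norm_le (w : 'rV[R]_n) :
        `|w| <= d + 2 * `|y| -> lp_norm p w <= N * (d + 2 * `|y|).
      by move=> wd; exact: le_trans (lp_norm_le w p0) (ler_wpM2l N0 wd).
    by rewrite ge_max; apply/andP; split; apply: norm_le; lra.
  move: (Num.max _ _) (lp_norm 2 _ ^+ 2) => A B AN dB AB.
  have : sigma * d ^+ 2 <= sigma * B by rewrite ler_wpM2l// ltW.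
  lra.
apply: (le_trans xd); rewrite lerD2r.
(* If [d <= 1], the summand 1 of the bound suffices. Otherwise [d + 2 |y| <= d (1 + 2 |y|)], and one
   factor [d] cancels in [main]. *)
have [d1|d1] := leP d 1.
  rewrite (le_trans d1)// lerDl mulr_ge0 ?divr_ge0 ?(ltW s0)//.
  by rewrite mulr_ge0//; lra.
rewrite (@le_trans _ _ (8 / sigma * (N * (1 + 2 * `|y|)))) ?lerDr//.
rewrite -ler_pdivrMl ?divr_gt0// invf_div -(ler_pM2r (lt_trans ltr01 d1)).
rewrite -mulrA -expr2 (le_trans main)// -[leRHS]mulrA ler_wpM2l//.
have : `|y| <= `|y| * d by rewrite ler_peMr// ltW.
lra.
Qed.

Theorem corollary2p6 (R : realType) (n : nat) (p : R) (C : set 'rV[R]_n)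
    (hp1 : 1 < p) (hp2 : p <= 2) (C_nonempty : C !=set0)
    (C_convex : convex_set C) :
  (exists sigma : R,
      0 < sigma /\ strongly_quasiconvex sigma C (fun x => (lp_norm p x)%:E))
  <-> bounded_set C.
Proof.
have p0 : 0 < p := lt_trans ltr01 hp1.
split=> [[sigma [s0 qc]]|].
  have [y Cy] := C_nonempty.
  (* [ex_bound] requires a proper filter; the point [y] makes the filter of supersets of [C] proper
     and also serves as base point of the bound. *)
  have PF := globally_properfilter Cy.
  apply/ex_bound; eexists => x Cx /=.
  exact: strongly_quasiconvex_lp_norm_bounded p0 s0 qc Cx Cy.
move=> /pinfty_ex_gt0[r r0 Cr].
have [sigma s0 qc] := lp_norm_strongly_quasiconvex hp1 hp2 r0 Cr.
by exists sigma.
Qed.
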